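(* Let $f=[g:g_1,\dots,g_s;h_1,\dots,h_r]$ be a differentiable convertible nonconvex function and let $(\boldsymbol{x}^*,\boldsymbol{y}^* )\in X(g)$. Suppose that at least one of the following two conditions holds: (a) $(\boldsymbol{x},\boldsymbol{y})-(\boldsymbol{x}^*,\boldsymbol{y}^* )\in T_0(\boldsymbol{x}^*,\boldsymbol{y}^* )$ for all $(\boldsymbol{x},\boldsymbol{y})\in X(g)$; (b) $X(f)\cap K_g(\boldsymbol{x}^*,\boldsymbol{y}^* )\cap\big[\,T(\boldsymbol{x}^*,\boldsymbol{y}^* )\setminus T_0(\boldsymbol{x}^*,\boldsymbol{y}^* )+(\boldsymbol{x}^*,\boldsymbol{y}^* )\,\big]=\emptyset$. If there are $\boldsymbol{u}^*=(u_1^*,\dots,u_s^* )^\top\ge 0$ and $\boldsymbol{v}^*=(v_1^*,\dots,v_r^* )^\top\in R^r$ such that $$\nabla g(\boldsymbol{x}^*,\boldsymbol{y}^* )+\sum_{i=1}^s u_i^*\nabla g_i(\boldsymbol{x}^*,\boldsymbol{y}^* )+\sum_{j=1}^r v_j^*\nabla h_j(\boldsymbol{x}^*,\boldsymbol{y}^* )=0,\qquad u_i^*g_i(\boldsymbol{x}^*,\boldsymbol{y}^* )=0\ \ (i=1,\dots,s),$$ then $\boldsymbol{x}^*$ is an optimal solution to (UOP).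
   Context: Let $f:R^n\to R$ be nonconvex or nonsmooth and let $g,g_i,h_j:R^n\times R^m\to R$ ($i=1,\dots,s$; $j=1,\dots,r$) be convex. Put $X(f)=\{(\boldsymbol{x},\boldsymbol{y}): g_i(\boldsymbol{x},\boldsymbol{y})\le 0\ (i=1,\dots,s),\ h_j(\boldsymbol{x},\boldsymbol{y})=0\ (j=1,\dots,r)\}$, $X(f(\boldsymbol{x}))=\{\boldsymbol{y}\in R^m: (\boldsymbol{x},\boldsymbol{y})\in X(f)\}$ for fixed $\boldsymbol{x}$, and $X(g)=\{(\boldsymbol{x},\boldsymbol{y})\in X(f): g(\boldsymbol{x},\boldsymbol{y})=f(\boldsymbol{x})\}$. The function $f$ is a convertible nonconvex function, written $f=[g:g_1,\dots,g_s;h_1,\dots,h_r]$, if for each $\boldsymbol{x}\in R^n$ there is $\bar{\boldsymbol{y}}\in X(f(\boldsymbol{x}))$ with $f(\boldsymbol{x})=g(\boldsymbol{x},\bar{\boldsymbol{y}})$ and $f(\boldsymbol{x})=\min_{\boldsymbol{y}\in X(f(\boldsymbol{x}))}g(\boldsymbol{x},\boldsymbol{y})$. It is a differentiable convertible nonconvex function if moreover all of $g,g_i,h_j$ are differentiable (with $s>0$); $f$ itself need not be differentiable or convex. (UOP) is the problem: minimize $f(\boldsymbol{x})$ over $\boldsymbol{x}\in R^n$. Optimal solution means global optimal solution. Gradients are with respect to $(\boldsymbol{x},\boldsymbol{y})$. For fixed $(\boldsymbol{x},\boldsymbol{y})$ define $T(\boldsymbol{x},\boldsymbol{y})=\{\boldsymbol{d}\in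 R^n\times R^m: g_i(\boldsymbol{x},\boldsymbol{y})+\nabla g_i(\boldsymbol{x},\boldsymbol{y})^\top\boldsymbol{d}\le 0\ (i=1,\dots,s),\ \nabla h_j(\boldsymbol{x},\boldsymbol{y})^\top\boldsymbol{d}\le 0\ (j=1,\dots,r)\}$, $T_0(\boldsymbol{x},\boldsymbol{y})=\{\boldsymbol{d}\in R^n\times R^m: g_i(\boldsymbol{x},\boldsymbol{y})+\nabla g_i(\boldsymbol{x},\boldsymbol{y})^\top\boldsymbol{d}\le 0\ (i=1,\dots,s),\ \nabla h_j(\boldsymbol{x},\boldsymbol{y})^\top\boldsymbol{d}=0\ (j=1,\dots,r)\}$, and $K_g(\boldsymbol{x}^*,\boldsymbol{y}^* )=\{(\boldsymbol{x},\boldsymbol{y})\in R^n\times R^m: \nabla g(\boldsymbol{x}^*,\boldsymbol{y}^* )^\top[(\boldsymbol{x},\boldsymbol{y})-(\boldsymbol{x}^*,\boldsymbol{y}^* )]<0\}$. The set $T\setminus T_0+(\boldsymbol{x}^*,\boldsymbol{y}^* )$ is the translate of $T\setminus T_0$ by $(\boldsymbol{x}^*,\boldsymbol{y}^* )$. *)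

(* Defs.v *)
From mathcomp Require Import all_boot all_order all_algebra.
From mathcomp Require Import all_classical all_reals all_analysis.
Import Order.TTheory GRing.Theory Num.Theory.
Import numFieldNormedType.Exports.

Set Implicit Arguments.
Unset Strict Implicit.
Unset Printing Implicit Defensive.

Local Open Scope classical_set_scope.
Local Open Scope ring_scope.

(* R^n x R^m; its componentwise module structure and its product topology are
   those of R^(n+m). *)
Notation RnRm R n m := ('rV[R]_n * 'rV[R]_m)%type.

Section ConvertibleNonconvexFunctions.
Context {R : realType} {n m : nat}.
Local Notation E := (RnRm R n m).
Implicit Types (f : 'rV[R]_n -> R) (g : E -> R) (p q d : E).

Definition dot p q : R :=
  \sum_(i < n) p.1 0 i * q.1 0 i + \sum_(j < m) p.2 0 j * q.2 0 j.

Definition grad g p : E :=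
  (\row_(i < n) 'D_((delta_mx 0 i, 0) : E) g p,
   \row_(j < m) 'D_((0, delta_mx 0 j) : E) g p).

Context {s r : nat}.
Implicit Types (gi : 'I_s -> E -> R) (hj : 'I_r -> E -> R).

Definition Xf gi hj : set E :=
  [set p | (forall i, gi i p <= 0) /\ (forall j, hj j p = 0)].

Definition Xf_at gi hj (x : 'rV[R]_n) : set 'rV[R]_m :=
  [set y | Xf gi hj (x, y)].

Definition Xg f g gi hj : set E := [set p | Xf gi hj p /\ g p = f p.1].

Definition is_min (A : set R) (a : R) : Prop := A a /\ lbound A a.

(* In finite dimension a differentiable convex function is C^1, so cvn_f means
   the same whether "smooth" is read as differentiable or as C^1. *)
Record convertible_nonconvex f g gi hj : Prop := ConvertibleNonconvex {
  cvn_f : ~ convex_function [set: 'rV[R]_n] f \/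
          ~ (forall x, differentiable f x);
  cvn_g : convex_function [set: E] g;
  cvn_gi : forall i, convex_function [set: E] (gi i);
  cvn_hj : forall j, convex_function [set: E] (hj j);
  cvn_min : forall x, exists ybar,
    [/\ Xf_at gi hj x ybar,
        f x = g (x, ybar) &
        is_min [set g (x, y) | y in Xf_at gi hj x] (f x)]
}.

Record differentiable_convertible_nonconvex f g gi hj : Prop :=
  DifferentiableConvertibleNonconvex {
  dcvn_convertible : convertible_nonconvex f g gi hj;
  dcvn_s : (0 < s)%N;
  dcvn_g : forall p, differentiable g p;
  dcvn_gi : forall i p, differentiable (gi i) p;
  dcvn_hj : forall j p, differentiable (hj j) p
}.

Definition T_set gi hj p : set E :=
  [set d | (forall i, gi i p + dot (grad (gi i) p) d <= 0) /\
           (forall j, dot (grad (hj j) p) d <= 0)].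

Definition T0_set gi hj p : set E :=
  [set d | (forall i, gi i p + dot (grad (gi i) p) d <= 0) /\
           (forall j, dot (grad (hj j) p) d = 0)].

Definition K_set g p : set E := [set q | dot (grad g p) (q - p) < 0].

Definition UOP_optimal f (x : 'rV[R]_n) : Prop := forall z, f x <= f z.

End ConvertibleNonconvexFunctions.

(* Main.v *)
Require Import Defs.
From mathcomp Require Import all_boot all_order all_algebra.
From mathcomp Require Import all_classical all_reals all_analysis.
From mathcomp Require Import ring.
Import Order.TTheory GRing.Theory Num.Theory.
Import numFieldNormedType.Exports.
Local Open Scope classical_set_scope.
Local Open Scope ring_scope.

(** Let p0 be the given KKT point.  The value f(z) at any z is attained as g(p)
    at some p = (z, y) in X(g), so it suffices to show g(p0) <= g(p) for every
    p in X(g).  By convexity g lies above its tangent hyperplane at p0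
    ([convex_ge_tangent]), which reduces the claim to the single inequality
    <grad g(p0), d> >= 0 for the displacement d = p - p0.

    Two facts give it.  The tangent inequality for the constraints puts the
    displacement of every feasible point in T(p0) ([feasible_displacement_T]);
    for h_j this yields only <grad h_j(p0), d> <= 0, since h_j need not be
    affine.  On T_0(p0), where the h_j-terms vanish, the stationarity and
    complementarity conditions force <grad g(p0), d> >= 0 ([kkt_T0_ascent]);
    on the rest of T(p0) they need not, because the multipliers v_j have no
    sign.  Condition (a) puts d in T_0(p0).  Condition (b) says that no
    feasible displacement in T(p0) outside T_0(p0) is a descent direction for
    g, so a negative <grad g(p0), d> would put d in T_0(p0), where it cannot be
    negative. *)

(** The chord inequality on the segment from p to q says that the difference
    quotient of g at p along q - p is at most g q - g p for every step in
    (0, 1]; the limit at 0 from the right keeps this bound. *)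
Lemma convex_ge_tangent (R : realType) (V : normedModType R) (g : V -> R)
    (p q : V) :
  convex_function [set: V] g -> derivable g p (q - p) ->
  g p + 'D_(q - p) g p <= g q.
Proof.
move=> cg dg; rewrite addrC -lerBrDr.
apply: (cvgr_to_le (cvg_dnbhs_at_right dg)).
near=> h.
have h0 : 0 < h by near: h; exact: nbhs_right_gt.
have h1 : h <= 1 by near: h; exact: nbhs_right_le.
have chord : g (h *: (q - p) + p) <= h * g q + (1 - h) * g p.
  have -> : h *: (q - p) + p = h *: q + (1 - h) *: p.
    by rewrite scalerBr scalerBl scale1r addrAC addrA.
  by have := cg (Itv01 (ltW h0) h1) q p; rewrite !inE => /(_ I I).
rewrite [_ *: _]mulrC ler_pdivrMr//.
suff <- : h * g q + (1 - h) * g p - g p = (g q - g p) * h by rewrite lerD2r.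
by ring.
Unshelve. all: by end_near. Qed.

Section ProductSpace.
Context {R : realType} {n m : nat}.
Local Notation E := (RnRm R n m).
Implicit Types (g : E -> R) (p q d : E).

Lemma dotDl p q d : dot (p + q) d = dot p d + dot q d.
Proof.
rewrite /dot addrACA -!big_split /=; congr (_ + _);
  by apply: eq_bigr => i _; rewrite mxE mulrDl.
Qed.

Lemma dotZl (a : R) p d : dot (a *: p) d = a * dot p d.
Proof.
rewrite /dot mulrDr !mulr_sumr; congr (_ + _);
  by apply: eq_bigr => i _; rewrite mxE mulrA.
Qed.

Lemma dot0l d : dot 0 d = 0.
Proof. by rewrite -(scale0r (0 : E)) dotZl mul0r. Qed.

Lemma dot_suml (I : finType) (F : I -> E) d :
  dot (\sum_i F i) d = \sum_i dot (F i) d.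
Proof.
apply: (big_morph (fun p => dot p d)); [by move=> p q; rewrite dotDl|].
exact: dot0l.
Qed.

(** [grad] collects only the partial derivatives; linearity of the differential
    on the standard basis recovers every directional derivative from them. *)
Lemma derive_dot_grad g p d :
  differentiable g p -> 'D_d g p = dot (grad g p) d.
Proof.
move=> dg.
have sum1 (F : 'I_n -> 'rV[R]_n) : \sum_i ((F i, 0) : E) = (\sum_i F i, 0).
  by apply/esym; apply: (big_morph (fun x => (x, 0) : E)) => // x y;
    rewrite -[in LHS](addr0 0).
have sum2 (F : 'I_m -> 'rV[R]_m) : \sum_j ((0, F j) : E) = (0, \sum_j F j).
  by apply/esym; apply: (big_morph (fun y => (0, y) : E)) => // x y;
    rewrite -[in LHS](addr0 0).
have dE : d = \sum_i d.1 0 i *: ((delta_mx 0 i, 0) : E) +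
              \sum_j d.2 0 j *: ((0, delta_mx 0 j) : E).
  transitivity (((d.1, 0) : E) + (0, d.2)).
    by rewrite [LHS]surjective_pairing; congr pair; rewrite ?addr0 ?add0r.
  rewrite {1}(row_sum_delta d.1) {1}(row_sum_delta d.2) -sum1 -sum2.
  by congr (_ + _); apply: eq_bigr => i _; congr pair; rewrite /= ?scaler0.
rewrite deriveE// {1}dE linearD !linear_sum /dot; congr (_ + _);
  by apply: eq_bigr => i _; rewrite linearZ /= mxE deriveE// mulrC.
Qed.

Lemma convex_gradient_le g p q :
  convex_function [set: E] g -> differentiable g p ->
  g p + dot (grad g p) (q - p) <= g q.
Proof.
move=> cg dg; rewrite -derive_dot_grad//.
exact: convex_ge_tangent cg (diff_derivable dg).
Qed.

Context {s r : nat}.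
Implicit Types (gi : 'I_s -> E -> R) (hj : 'I_r -> E -> R).

Lemma feasible_displacement_T gi hj p q :
  (forall i, convex_function [set: E] (gi i)) ->
  (forall j, convex_function [set: E] (hj j)) ->
  (forall i, differentiable (gi i) p) -> (forall j, differentiable (hj j) p) ->
  Xf gi hj p -> Xf gi hj q -> T_set gi hj p (q - p).
Proof.
move=> cgi chj dgi dhj [_ hp0] [gq0 hq0]; split=> [i|j].
  exact: le_trans (convex_gradient_le _ _ q (cgi i) (dgi i)) (gq0 i).
by have := convex_gradient_le _ _ q (chj j) (dhj j); rewrite hp0 hq0 add0r.
Qed.

(** Pairing the stationarity equation with d leaves
    <grad g, d> = - \sum_i u_i <grad g_i, d>, and complementarity turns each
    u_i <grad g_i, d> into u_i (g_i + <grad g_i, d>) <= 0. *)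
Lemma kkt_T0_ascent g gi hj p d (u : 'rV[R]_s) (v : 'rV[R]_r) :
  (forall i, 0 <= u 0 i) ->
  grad g p + \sum_(i < s) u 0 i *: grad (gi i) p
    + \sum_(j < r) v 0 j *: grad (hj j) p = 0 ->
  (forall i, u 0 i * gi i p = 0) ->
  T0_set gi hj p d -> 0 <= dot (grad g p) d.
Proof.
move=> u0 stat compl [gd hd].
have := congr1 (fun w => dot w d) stat.
rewrite dot0l !dotDl !dot_suml [X in _ + X]big1 ?addr0; last first.
  by move=> j _; rewrite dotZl hd mulr0.
move/eqP; rewrite addr_eq0 => /eqP ->; rewrite oppr_ge0.
apply: sumr_le0 => i _; rewrite dotZl.
have -> : u 0 i * dot (grad (gi i) p) d =
          u 0 i * (gi i p + dot (grad (gi i) p) d) by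
  rewrite [RHS]mulrDr compl add0r.
by rewrite mulr_ge0_le0.
Qed.

End ProductSpace.

Theorem theorem5 (R : realType) (n m s r : nat)
    (f : 'rV[R]_n -> R) (g : RnRm R n m -> R)
    (gi : 'I_s -> RnRm R n m -> R) (hj : 'I_r -> RnRm R n m -> R)
    (hf : differentiable_convertible_nonconvex f g gi hj)
    (xs : 'rV[R]_n) (ys : 'rV[R]_m)
    (hX : Xg f g gi hj (xs, ys))
    (hab :
      (forall (x : 'rV[R]_n) (y : 'rV[R]_m), Xg f g gi hj (x, y) ->
         T0_set gi hj (xs, ys) ((x, y) - (xs, ys)))
      \/
      Xf gi hj `&` K_set g (xs, ys) `&`
        [set d + (xs, ys) |
           d in T_set gi hj (xs, ys) `\` T0_set gi hj (xs, ys)] = set0)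
    (hKKT : exists (u : 'rV[R]_s) (v : 'rV[R]_r),
      [/\ forall i, 0 <= u 0 i,
          grad g (xs, ys) + \sum_(i < s) u 0 i *: grad (gi i) (xs, ys)
            + \sum_(j < r) v 0 j *: grad (hj j) (xs, ys) = 0 &
          forall i, u 0 i * gi i (xs, ys) = 0]) :
  UOP_optimal f xs.
Proof.
case: hf => [[_ cg cgi chj fmin] _ dg dgi dhj] z.
case: hKKT => u [v [u0 stat compl]].
have ascent := kkt_T0_ascent _ _ _ _ _ _ _ u0 stat compl.
case: hX => feas_s /= gsE.
have [y [/= feas_y fzE _]] := fmin z.
rewrite -gsE fzE.
suff dir : 0 <= dot (grad g (xs, ys)) ((z, y) - (xs, ys)).
  apply: le_trans (convex_gradient_le _ (xs, ys) (z, y) cg (dg _)).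
  by rewrite lerDl.
case: hab => [inT0|noDescent].
  by apply: ascent; apply: inT0; split.
rewrite leNgt; apply/negP => descent.
have [inT0|notT0] := pselect (T0_set gi hj (xs, ys) ((z, y) - (xs, ys))).
  by have := ascent _ inT0; rewrite leNgt descent.
(* A descent direction outside T_0 makes (z, y) a member of the set that
   condition (b) declares empty. *)
suff : set0 (z, y) by [].
rewrite -noDescent; split; first by split.
exists ((z, y) - (xs, ys)); last by rewrite subrK.
split=> //; exact: feasible_displacement_T.
Qed.
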